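(* Let $G$ be a finite simple unweighted graph on $n$ vertices, and let $m$ be an integer with $1\le m\le n-1$. If $\bar{G}\neq K_m+(n-m)K_1$, then $\lambda_{m+1}(G)\le d_m(G)+m-1$.
   Context: For a graph $G$ on $n$ vertices, $L(G)=D(G)-A(G)$ is its Laplacian matrix, where $A(G)$ is the adjacency matrix and $D(G)$ the diagonal matrix of vertex degrees. The Laplacian eigenvalues are listed in nondecreasing order $0=\lambda_1(G)\le\lambda_2(G)\le\dots\le\lambda_n(G)$, and the degrees in nondecreasing order $d_1(G)\le d_2(G)\le\dots\le d_n(G)$, so $d_m(G)$ is the $m$-th smallest degree. $\bar G$ denotes the complement graph of $G$, $K_m$ the complete graph on $m$ vertices, $K_1$ a single vertex, and $K_m+(n-m)K_1$ the disjoint union of $K_m$ with $n-m$ isolated vertices. *)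

(* Defs.v *)
From mathcomp Require Import all_boot all_order all_algebra.
From mathcomp Require Import polyrcf.
Set Implicit Arguments.
Unset Strict Implicit.
Unset Printing Implicit Defensive.
Import Order.TTheory GRing.Theory Num.Theory.
Local Open Scope ring_scope.

Record sgraph (T : finType) := SGraph {
  adj :> rel T;
  adj_sym : symmetric adj;
  adj_irrefl : irreflexive adj }.

Definition isomorphic (T U : finType) (G : sgraph T) (H : sgraph U) : Prop :=
  exists2 f : T -> U, bijective f & forall x y, H (f x) (f y) = G x y.

Section Complement.
Variables (T : finType) (G : sgraph T).

Definition compl_adj : rel T := fun x y => (x != y) && ~~ G x y.

Lemma compl_adj_sym : symmetric compl_adj.
Proof. by move=> x y; rewrite /compl_adj eq_sym adj_sym. Qed.

Lemma compl_adj_irrefl : irreflexive compl_adj.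
Proof. by move=> x; rewrite /compl_adj eqxx. Qed.

Definition complement : sgraph T := SGraph compl_adj_sym compl_adj_irrefl.
End Complement.

Section Complete.
Variable k : nat.

Definition complete_adj : rel 'I_k := fun i j => i != j.

Lemma complete_adj_sym : symmetric complete_adj.
Proof. by move=> i j; rewrite /complete_adj eq_sym. Qed.

Lemma complete_adj_irrefl : irreflexive complete_adj.
Proof. by move=> i; rewrite /complete_adj eqxx. Qed.

Definition complete_graph : sgraph 'I_k :=
  SGraph complete_adj_sym complete_adj_irrefl.
End Complete.

(* k K_1 *)
Definition edgeless_graph (k : nat) : sgraph 'I_k :=
  @SGraph _ (fun _ _ => false) (fun _ _ => erefl) (fun _ => erefl).

Section DisjointUnion.
Variables (T U : finType) (G : sgraph T) (H : sgraph U).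

Definition union_adj : rel (T + U)%type := fun u v =>
  match u, v with
  | inl x, inl y => G x y
  | inr x, inr y => H x y
  | _, _ => false
  end.

Lemma union_adj_sym : symmetric union_adj.
Proof. by move=> [x|x] [y|y] //=; rewrite adj_sym. Qed.

Lemma union_adj_irrefl : irreflexive union_adj.
Proof. by move=> [x|x] /=; rewrite adj_irrefl. Qed.

Definition disjoint_union : sgraph (T + U)%type :=
  SGraph union_adj_sym union_adj_irrefl.
End DisjointUnion.

Section Degrees.
Variables (T : finType) (G : sgraph T).

Definition degree (x : T) : nat := #|[set y | G x y]|.

Definition degree_seq : seq nat := sort leq [seq degree x | x <- enum T].

(* The m-th smallest degree, counting from m = 1 up to #|T|. *)
Definition nth_degree (m : nat) : nat := nth 0%N degree_seq m.-1.
End Degrees.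

(* Rows and columns are indexed by 'I_#|T|, standing for the vertices through
   enum_val. *)
Section Laplacian.
Variables (R : rcfType) (T : finType) (G : sgraph T).

Definition adjacency_matrix : 'M[R]_#|T| :=
  \matrix_(i, j) (G (enum_val i) (enum_val j))%:R.

Definition degree_matrix : 'M[R]_#|T| :=
  diag_mx (\row_i (degree G (enum_val i))%:R).

Definition laplacian : 'M[R]_#|T| := degree_matrix - adjacency_matrix.
End Laplacian.

(* rootsR lists the distinct roots in R of a nonzero polynomial in increasing
   order; each one is repeated according to its algebraic multiplicity.  For a
   symmetric A, whose characteristic polynomial splits over R, the resulting
   list has length n. *)
Definition eigenvalues (R : rcfType) (n : nat) (A : 'M[R]_n) : seq R :=
  flatten [seq nseq (mup x (char_poly A)) x | x <- rootsR (char_poly A)].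

(* The k-th smallest Laplacian eigenvalue, counting from k = 1 up to #|T|. *)
Definition laplacian_eigenvalue (R : rcfType) (T : finType) (G : sgraph T)
    (k : nat) : R :=
  nth 0 (eigenvalues (laplacian R G)) k.-1.

(* Main.v *)
(* This is the complementary form of the Brouwer-Haemers bound.  Put
   [H = complement G] and [t = n - (d + m - 1)], with [d] the m-th smallest
   degree of [G], and let [S] consist of m vertices whose G-degree is at most
   [d].  Since [L(G) + L(H) = n I - J], it suffices to find an m-dimensional
   space orthogonal to the constants on which [L(H) >= t]; adjoining the
   constants gives an (m+1)-dimensional space on which [L(G) <= n - t], and
   Courant-Fischer concludes.  The space consists of the functions
   [x - (sum x) g], where [x] is supported on [S] and [g] is a fixed function of
   sum 1.

   Every vertex of [S] has at least [t - 1] H-neighbours outside [S], and if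
   some vertex has exactly [t - 1] of them, it is H-adjacent to all the others
   in [S].  In most cases [g] is the uniform weight on [S] and a set of chosen
   outer neighbours: all vertices outside [S] if everybody has [t] of them; at
   most [m (t - 1)] of them if [t >= 2]; one for each vertex that has any if
   [t = 1].  In the remaining case [S] is an isolated clique of [H], and as [H]
   is not [K_m + (n - m) K_1] there is an edge [uv] outside [S]; then [g] is
   uniform on [S] plus the dipole [delta_v - delta_u]. *)
Require Import Defs.
From mathcomp Require Import all_boot all_order all_algebra.
From mathcomp Require Import polyrcf complex spectral sesquilinear.
From mathcomp Require Import ring lra zify.
Set Implicit Arguments.
Unset Strict Implicit.
Unset Printing Implicit Defensive.
Import Order.TTheory GRing.Theory Num.Theory.
Local Open Scope ring_scope.

(** * Courant-Fischer over a real closed field *)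

(** With [w = X + 'i Y], the mixed terms cancel by symmetry of [B], leaving the real form at [X]
    plus that at [Y]. This carries semidefiniteness over to [R[i]], where the diagonalisation takes
    place. *)
Lemma psd_complexification (R : rcfType) n (B : 'M[R]_n) (w : 'rV[R[i]]_n) :
    B^T = B -> (forall v : 'rV[R]_n, 0 <= (v *m B *m v^T) 0 0) ->
  0 <= (w *m map_mx (real_complex R) B *m map_mx Num.conj w^T) 0 0.
Proof.
move=> symB psdB.
pose X := map_mx (@complex.Re R) w; pose Y := map_mx (@complex.Im R) w.
have wE : w = map_mx (real_complex R) X + 'i *: map_mx (real_complex R) Y.
  by apply/matrixP=> i j; rewrite !mxE -complexiE -complexE.
have wJ : map_mx Num.conj w^T =
          map_mx (real_complex R) X^T - 'i *: map_mx (real_complex R) Y^T.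
  apply/matrixP=> i j; rewrite !mxE {1}[w j i]complexE complexiE rmorphD
    rmorphM /=.
  by rewrite conjCi !conj_Creal ?mulNr // complex_real.
(* A 1 x 1 matrix equals its transpose. *)
have cross : Y *m B *m X^T = X *m B *m Y^T.
  rewrite -[LHS]trmxK; have -> : (Y *m B *m X^T)^T = X *m B *m Y^T.
    by rewrite !trmx_mul trmxK symB mulmxA.
  by apply/matrixP=> i j; rewrite !ord1 mxE.
have -> : w *m map_mx (real_complex R) B *m map_mx Num.conj w^T =
    map_mx (real_complex R) (X *m B *m X^T + Y *m B *m Y^T).
  rewrite wJ {1}wE map_mxD !map_mxM !mulmxDl !mulmxBr -!scalemxAl -!scalemxAr.
  rewrite -!map_mxM cross scalerA -expr2 sqrCi scaleN1r.
  by rewrite !addrA opprK subrK.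
by rewrite mxE ler0c mxE addr_ge0.
Qed.

Lemma char_poly_diag (F : comNzRingType) n (d : 'rV[F]_n) :
  char_poly (diag_mx d) = \prod_(i < n) ('X - (d 0 i)%:P).
Proof.
rewrite char_poly_trig ?diag_mx_is_trig //.
by apply: eq_bigr => i _; rewrite mxE eqxx.
Qed.

(** Over [R[i]] the matrix is hermitian, hence unitarily diagonalisable with real spectrum; the
    factorisation descends to [R] because the embedding is injective on polynomials. *)
Lemma spectral_real (R : rcfType) n (A : 'M[R]_n) (symA : A^T = A) :
  let AM := map_mx (real_complex R) A in
  exists2 a : 'I_n -> R,
    AM = invmx (spectralmx AM) *m diag_mx (\row_i (a i)%:C%C) *m spectralmx AM &
    char_poly A = \prod_(i < n) ('X - (a i)%:P).
Proof.
move=> AM.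
have hA : AM \is hermsymmx.
  apply: realsym_hermsym.
    apply/is_hermitianmxP; rewrite expr0 scale1r map_mx_id //.
    by rewrite /AM map_trmx symA.
  by apply/mxOverP => i j; rewrite mxE complex_real.
have dR := hermitian_spectral_diag_real hA.
have /orthomx_spectralP eqA := hermitian_normalmx hA.
pose a i := complex.Re (spectral_diag AM 0 i).
have aE : spectral_diag AM = \row_i (a i)%:C%C.
  by apply/rowP => i; rewrite mxE /a RRe_real // (mxOverP dR).
exists a; first by rewrite -aE.
apply: (map_poly_inj (real_complex R)).
rewrite map_char_poly -/AM rmorph_prod /=.
under eq_bigr do rewrite map_polyXsubC.
(* Similarity: ['X - P^-1 D P] is [P^-1 ('X - D) P], and the determinants of [P^-1] and [P]
   cancel. *)
have -> : char_poly AM = char_poly (diag_mx (spectral_diag AM)).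
  have uP := spectral_unit AM; set P := spectralmx AM in eqA uP *.
  rewrite {1}eqA /char_poly /char_poly_mx !map_mxM /=.
  set PX := map_mx _ P; set QX := map_mx _ (invmx P).
  have QP : QX *m PX = 1%:M by rewrite -map_mxM mulVmx // map_mx1.
  rewrite -[X in \det (X - _)]mulmx1 -QP mul_scalar_mx -mulmxA scalemxAr.
  rewrite -mulmxBr -mul_scalar_mx -mulmxBl !det_mulmx mulrCA -det_mulmx.
  by rewrite QP det1 mulr1.
rewrite aE char_poly_diag.
by apply: eq_bigr => i _; rewrite mxE.
Qed.

Lemma count_mem_eigenvalues (R : rcfType) n (A : 'M[R]_n) x :
  count_mem x (eigenvalues A) = mup x (char_poly A).
Proof.
have p0 : char_poly A != 0 by rewrite monic_neq0 ?char_poly_monic.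
rewrite /eigenvalues count_flatten -map_comp sumnE big_map.
transitivity (\sum_(y <- rootsR (char_poly A)) (y == x) * mup y (char_poly
  A))%N.
  by apply: eq_bigr => y _; exact: count_nseq.
have [xr|xr] := boolP (x \in rootsR (char_poly A)).
  rewrite (bigD1_seq x) ?uniq_roots //= eqxx mul1n big1 ?addn0 // => y.
  by move=> /negPf->.
rewrite big1_seq => [|y /andP[_ yr]]; last first.
  by case: eqP yr xr => // -> ->.
by rewrite mupNroot //; move: xr; rewrite -(roots_on_rootsR p0 x).
Qed.

Lemma sorted_eigenvalues (R : rcfType) n (A : 'M[R]_n) :
  sorted <=%R (eigenvalues A).
Proof.
rewrite /eigenvalues /rootsR; set r := roots _ _ _.
have: sorted <=%R r by apply: sub_sorted (sorted_roots _ _ _) => y z;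
  apply: ltW.
elim: r => //= x r IH; rewrite (path_sortedE le_trans) => /andP[xr /IH rs].
rewrite sorted_pairwise; last exact: le_trans.
rewrite pairwise_cat -!sorted_pairwise ?rs ?andbT; try exact: le_trans.
apply/andP; split.
  apply/allrelP => y z /nseqP[-> _] /flattenP[s /mapP[u ur ->]] /nseqP[-> _].
  by rewrite (allP xr).
by elim: (mup _ _) => // k; case: k => //= k ->; rewrite lexx.
Qed.

(** Each value occurs on both sides as often as its multiplicity as a root of the characteristic
    polynomial. *)
Lemma perm_eigenvalues (R : rcfType) n (A : 'M[R]_n) (a : 'I_n -> R) :
  char_poly A = \prod_(i < n) ('X - (a i)%:P) ->
  perm_eq (eigenvalues A) (codom a).
Proof.
move=> cA; apply/allP => x _ /=; apply/eqP; rewrite count_mem_eigenvalues cA.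
rewrite -(mu_prod_XsubC x (codom a)); congr mup.
by rewrite /codom /image_mem big_map big_enum.
Qed.

(** The upper half of the min-max principle, by contradiction: otherwise the row space of [Y],
    extended to [R[i]], contains a nonzero vector with components only along eigenvalues above [th],
    where the form of [th - A] is negative. *)
Lemma courant_fischer (R : rcfType) n k (A : 'M[R]_n) (Y : 'M[R]_(k, n)) th :
    A^T = A -> (0 < k)%N -> row_free Y ->
    (forall w : 'rV[R]_k,
      ((w *m Y) *m A *m (w *m Y)^T) 0 0 <= th * ((w *m Y) *m (w *m Y)^T) 0 0) ->
  nth 0 (eigenvalues A) k.-1 <= th.
Proof.
move=> symA k_gt0 freeY leY; rewrite leNgt; apply/negP => th_lt.
have [a eqA cA] := spectral_real symA.
have pa := perm_eigenvalues cA.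
set AM := map_mx _ A in eqA; set P := spectralmx AM in eqA.
have uP : P \is unitarymx by apply: spectral_unitarymx.
have k_le : (k <= n)%N by rewrite -(eqP freeY) rank_leq_col.
(* Fewer than [k] eigenvalues are at most [th], so some nonzero vector of the
   k-dimensional row space of [Y] has no component along their eigenvectors. *)
pose J := [set i | a i <= th].
have J_lt : (#|J| < k)%N.
  have szE : size (eigenvalues A) = n.
    by rewrite (perm_size pa) size_codom card_ord.
  have -> : #|J| = count (fun x => x <= th) (eigenvalues A).
    rewrite (permP pa) count_map cardE /enum_mem size_filter.
    by rewrite count_filter; apply: eq_count => i; rewrite /= !inE andbT.
  (* The list is sorted, so all entries from index [k.-1] on exceed [th]; only [k.-1] entries
     precede them. *)
  rewrite -[eigenvalues A](cat_take_drop k.-1) count_cat.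
  have -> : count (fun x => x <= th) (drop k.-1 (eigenvalues A)) = 0%N.
    apply/eqP; rewrite -leqn0 leqNgt -has_count; apply/hasPn => x xd.
    rewrite -ltNge; apply: (lt_le_trans th_lt).
    case/(nthP 0): xd => i; rewrite size_drop szE nth_drop => i_lt <-.
    apply: sorted_leq_nth => //; first exact: le_trans.
    - exact: sorted_eigenvalues.
    - by rewrite inE szE prednK.
    - by rewrite inE szE; rewrite ltn_subRL in i_lt.
    - exact: leq_addr.
  rewrite addn0; apply: (leq_ltn_trans (count_size _ _)).
  by rewrite size_take szE prednK // k_le ltn_predL.
pose YC := map_mx (real_complex R) Y.
have freeYC : row_free YC by rewrite /row_free mxrank_map.
(* [Sel] retains the coordinates in [J]; the product below has [k] rows and fewer columns, so its
   left kernel is nonzero. *)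
pose Sel : 'M[R[i]]_(n, #|J|) := \matrix_(i, j) (i == enum_val j)%:R.
have /rowV0Pn[w /sub_kermxP wZ w0] :
    kermx (YC *m map_mx Num.conj P^T *m Sel) != 0.
  by rewrite kermx_eq0 /row_free neq_ltn (leq_ltn_trans (rank_leq_col _)).
(* [u] holds the coordinates of [w *m YC] in the eigenbasis formed by the rows of [P]. *)
have [u uPE uSel] : exists2 u, u *m P = w *m YC & u *m Sel = 0.
  exists (w *m YC *m map_mx Num.conj P^T); last first.
    by rewrite -!mulmxA mulmxA in wZ *.
  by rewrite -(invmx_unitary uP) mulmxKV ?unitarymx_unit.
have u0 : u != 0.
  apply: contra_neq w0 => u0; move: uPE; rewrite u0 mul0mx => /esym eq0.
  by apply: (row_free_inj freeYC); rewrite eq0 mul0mx.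
have uJ i : i \in J -> u 0 i = 0.
  move=> iJ; have /rowP/(_ (enum_rank_in iJ i)) := uSel.
  rewrite !mxE (bigD1 i) //= mxE enum_rankK_in // eqxx mulr1.
  rewrite big1 ?addr0 // => j ji; rewrite mxE enum_rankK_in //.
  by rewrite (negPf ji) mulr0.
have: 0 <= (w *m map_mx (real_complex R) (Y *m (th%:M - A) *m Y^T) *m
    map_mx Num.conj w^T) 0 0.
  apply: psd_complexification.
    by rewrite !trmx_mul trmxK linearB /= symA tr_scalar_mx mulmxA.
  move=> v; have := leY v; rewrite -subr_ge0.
  suff -> : v *m (Y *m (th%:M - A) *m Y^T) *m v^T =
     th *: ((v *m Y) *m (v *m Y)^T) - (v *m Y) *m A *m (v *m Y)^T.
    by rewrite !mxE.
  rewrite !trmx_mul !(mulmxBr, mulmxBl) mul_mx_scalar.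
  by rewrite -!(scalemxAl, scalemxAr) !mulmxA.
have -> : w *m map_mx (real_complex R) (Y *m (th%:M - A) *m Y^T) *m
    map_mx Num.conj w^T = u *m diag_mx (\row_i (th - a i)%:C%C) *m
    map_mx Num.conj u^T.
  have -> : diag_mx (\row_i (th - a i)%:C%C) =
      P *m map_mx (real_complex R) (th%:M - A) *m map_mx Num.conj P^T.
    rewrite map_mxB map_scalar_mx /= -/AM eqA mulmxBr mulmxBl -invmx_unitary //.
    rewrite mul_mx_scalar -scalemxAl mulmxV ?unitarymx_unit // mulmxA.
    rewrite mulmxA mulmxV ?unitarymx_unit // mul1mx mulmxK ?unitarymx_unit //.
    by apply/matrixP => i j; rewrite !mxE rmorphB mulrnBl mulr_natr.
  have uPJ : map_mx Num.conj P^T *m map_mx Num.conj u^T =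
      map_mx (real_complex R) Y^T *m map_mx Num.conj w^T.
    have -> : map_mx (real_complex R) Y^T = map_mx Num.conj YC^T.
      by apply/matrixP => i j; rewrite !mxE /= conj_Creal // complex_real.
    by rewrite -!map_mxM -!trmx_mul uPE.
  by rewrite -!mulmxA uPJ !mulmxA uPE !map_mxM /= !mulmxA.
have uPos i : (th - a i)%:C%C * (u 0 i * Num.conj (u 0 i)) <= 0.
  have [ai|ai] := leP (a i) th; first by rewrite uJ ?inE // mul0r mulr0.
  by rewrite mulr_le0_ge0 ?mul_conjC_ge0 // -[0]/(0%:C%C) lecR subr_le0 ltW.
have -> : (u *m diag_mx (\row_i (th - a i)%:C%C) *m map_mx Num.conj u^T) 0 0 =
    \sum_i (th - a i)%:C%C * (u 0 i * Num.conj (u 0 i)).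
  rewrite mul_mx_diag mxE; apply: eq_bigr => i _; rewrite !mxE /=.
  by rewrite mulrCA mulrA.
(* A nonzero coordinate lies outside [J], so its term is strictly negative while all others are at
   most 0. *)
have /rV0Pn[i ui] := u0.
rewrite (bigD1 i) //= => S_ge0.
have ai : th < a i.
  by rewrite ltNge; apply: contra_neqN ui => ai; rewrite uJ ?inE.
have : (th - a i)%:C%C * (u 0 i * Num.conj (u 0 i)) < 0.
  by rewrite pmulr_llt0 ?mul_conjC_gt0 // -[0]/(0%:C%C) ltcR subr_lt0.
have rest_le0 : \sum_(j | j != i) (th - a j)%:C%C * (u 0 j * Num.conj (u 0 j))
  <= 0.
  by apply: sumr_le0 => j _; exact: uPos.
move=> /(ler_ltD rest_le0); rewrite addrC addr0 => S_lt0.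
by rewrite (le_gtF S_ge0) in S_lt0.
Qed.

(** * The Laplacian form of a graph and of its complement *)

(* Twice the Laplacian quadratic form: each edge is counted in both
   directions. *)
Definition energy (R : pzRingType) (T : finType) (G : rel T) (f : T -> R) : R :=
  \sum_u \sum_v (G u v)%:R * (f u - f v) ^+ 2.

Lemma laplacian_sym (R : rcfType) (T : finType) (G : sgraph T) :
  (laplacian R G)^T = laplacian R G.
Proof.
rewrite /laplacian linearB /= tr_diag_mx; congr (_ - _).
by apply/matrixP => i j; rewrite !mxE adj_sym.
Qed.

Lemma sum_enum_val (V : nmodType) (T : finType) (F : T -> V) :
  \sum_u F u = \sum_(i < #|T|) F (enum_val i).
Proof.
apply: reindex; exists enum_rank => x _; first exact: enum_valK.
exact: enum_rankK.
Qed.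

(** Adding to the expanded form its copy with the two endpoints exchanged completes the squares. *)
Lemma laplacian_form (R : rcfType) (T : finType) (G : sgraph T) (f : T -> R)
    (v := \row_i f (enum_val i)) :
  (v *m laplacian R G *m v^T) 0 0 *+ 2 = energy G f.
Proof.
have degE u : (degree G u)%:R = \sum_v (G u v)%:R :> R.
  rewrite /degree -sum1_card natr_sum big_mkcond /=.
  by apply: eq_bigr => w _; rewrite inE; case: (G u w).
have -> : (v *m laplacian R G *m v^T) 0 0 =
    \sum_u \sum_w (G u w)%:R * (f u ^+ 2 - f u * f w).
  rewrite /laplacian mulmxBr mulmxBl mxE [X in _ + X]mxE mul_mx_diag !mxE.
  rewrite -sumrB [RHS]sum_enum_val.
  apply: eq_bigr => i _; rewrite !mxE degE.
  rewrite [in RHS]sum_enum_val.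
  rewrite [X in f _ * X]sum_enum_val.
  rewrite mulrAC mulr_sumr mulr_suml -sumrB; apply: eq_bigr => j _.
  by rewrite !mxE adj_sym; ring.
have symE : \sum_u \sum_w (G u w)%:R * (f u ^+ 2 - f u * f w) =
    \sum_u \sum_w (G u w)%:R * (f w ^+ 2 - f u * f w).
  rewrite exchange_big /=; apply: eq_bigr => u _; apply: eq_bigr => w _.
  by rewrite adj_sym [f w * _]mulrC.
rewrite mulr2n {2}symE -big_split; apply: eq_bigr => u _ /=.
by rewrite -big_split; apply: eq_bigr => w _ /=; ring.
Qed.

(** Courant-Fischer for functions on vertices: the [F i] are the rows of [Y], and the doubled
    right-hand side matches [energy]. *)
Lemma laplacian_eigenvalue_le (R : rcfType) (T : finType) (G : sgraph T) k
    (F : 'I_k -> T -> R) (th : R) :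
    (0 < k)%N ->
    (forall c : 'I_k -> R,
      (forall u, \sum_i c i * F i u = 0) -> forall i, c i = 0) ->
    (forall c : 'I_k -> R,
      energy G (fun u => \sum_i c i * F i u) <=
      (th * \sum_u (\sum_i c i * F i u) ^+ 2) *+ 2) ->
  laplacian_eigenvalue R G k <= th.
Proof.
move=> k_gt0 freeF leF.
pose Y : 'M[R]_(k, #|T|) := \matrix_(i, j) F i (enum_val j).
have YE w : w *m Y = \row_j \sum_i w 0 i * F i (enum_val j).
  by apply/rowP => j; rewrite !mxE; apply: eq_bigr => i _; rewrite mxE.
apply: (@courant_fischer _ _ _ _ Y) => //; first exact: laplacian_sym.
  apply: inj_row_free => w; rewrite YE => /rowP wY.
  apply/rowP => i; rewrite mxE; apply: (freeF (w 0)) => u.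
  by have := wY (enum_rank u); rewrite !mxE;
    under eq_bigr do rewrite enum_rankK.
move=> w; rewrite YE -(@ler_pMn2r _ 2) // (laplacian_form _ (fun u => \sum_i w
  0 i * F i u)).
apply: (le_trans (leF _)); rewrite ler_pMn2r //.
rewrite le_eqVlt; apply/orP; left; apply/eqP; congr (_ * _).
rewrite !mxE sum_enum_val.
by apply: eq_bigr => j _; rewrite !mxE expr2.
Qed.

(** The two graphs partition the pairs of distinct vertices, so the sum is the energy of the
    complete graph; this is [L(G) + L(H) = n I - J] as forms. *)
Lemma energy_complement (R : rcfType) (T : finType) (G : sgraph T) (f : T -> R)
  :
  energy G f + energy (complement G) f =
  (#|T|%:R * \sum_u f u ^+ 2 - (\sum_u f u) ^+ 2) *+ 2.
Proof.
have -> : energy G f + energy (complement G) f = \sum_u \sum_v (f u - f v) ^+ 2.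
  rewrite -big_split; apply: eq_bigr => u _ /=; rewrite -big_split.
  apply: eq_bigr => v _ /=; rewrite /compl_adj.
  have [<-|_] := eqVneq u v; first by rewrite subrr expr0n !mulr0 addr0.
  by case: (G u v); rewrite /= ?mul1r ?mul0r ?addr0 ?add0r.
have sqE : (\sum_u f u) ^+ 2 = \sum_u \sum_v f u * f v.
  by rewrite expr2 mulr_suml; apply: eq_bigr => u _; rewrite mulr_sumr.
have cE : #|T|%:R * (\sum_u f u ^+ 2) = \sum_u \sum_(v : T) f u ^+ 2.
  rewrite mulr_sumr; apply: eq_bigr => u _.
  by rewrite sumr_const mulr_natl.
have cE' : \sum_u \sum_(v : T) f u ^+ 2 = \sum_(u : T) \sum_v f v ^+ 2.
  exact: exchange_big.
rewrite mulr2n {2}cE cE' cE sqE -!sumrB -big_split; apply: eq_bigr => u _ /=.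
rewrite -!sumrB -big_split; apply: eq_bigr => v _ /=; ring.
Qed.

(** The test space is spanned by the constants and the functions [delta_s - g] for [s] in [S], which
    sum to 0. The vertex [w] ensures independence: there [y] is [- (sum x) * g w], so [y = 0] forces
    [sum x = 0] and then [x = 0]. *)
Lemma laplacian_eigenvalue_complement_le (R : rcfType) (T : finType)
    (G : sgraph T) (S : {set T}) (g : T -> R) (w : T) (t : R) :
    w \notin S -> g w != 0 -> \sum_u g u = 1 -> t <= #|T|%:R ->
    (forall x : T -> R, (forall u, u \notin S -> x u = 0) ->
      let y u := x u - (\sum_v x v) * g u in
      t * (\sum_u y u ^+ 2) *+ 2 <= energy (complement G) y) ->
  laplacian_eigenvalue R G #|S|.+1 <= #|T|%:R - t.
Proof.
move=> wS gw g1 t_le gap.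
pose F (i : 'I_#|S|.+1) u : R :=
  if unlift ord0 i is Some j then (u == enum_val j)%:R - g u else 1.
pose x (c : 'I_#|S|.+1 -> R) u := \sum_j c (lift ord0 j) * (u == enum_val j)%:R.
pose y c u := x c u - (\sum_v x c v) * g u.
have xS c u : u \notin S -> x c u = 0.
  move=> uS; rewrite /x big1 // => j _; case: eqP => [uj|];
    last by rewrite mulr0.
  by rewrite uj enum_valP in uS.
have sumx c : \sum_v x c v = \sum_j c (lift ord0 j).
  rewrite exchange_big; apply: eq_bigr => j _ /=; rewrite -mulr_sumr.
  by rewrite (bigD1 (enum_val j)) //= eqxx big1 ?addr0 ?mulr1 // => u /negPf->.
have FE c u : \sum_i c i * F i u = c ord0 + y c u.
  rewrite big_ord_recl /F unlift_none mulr1; congr (_ + _).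
  rewrite /y sumx mulr_suml /x -sumrB; apply: eq_bigr => j _.
  by rewrite liftK mulrBr.
have sumy c : \sum_u y c u = 0.
  by rewrite /y sumrB -mulr_sumr g1 mulr1 subrr.
have sumFE c : \sum_u (c ord0 + y c u) = #|T|%:R * c ord0.
  by rewrite big_split /= sumy addr0 sumr_const mulr_natl.
have T_neq0 : #|T|%:R != 0 :> R.
  by rewrite pnatr_eq0 -lt0n; apply/card_gt0P; exists w.
apply: (@laplacian_eigenvalue_le _ _ _ _ F) => // [c F0 i|c].
  have c0 : c ord0 = 0.
    apply: (mulfI T_neq0); rewrite mulr0 -sumFE big1 // => u _.
    by rewrite -FE F0.
  have y0 u : y c u = 0 by have := FE c u; rewrite F0 c0 add0r.
  have X0 : \sum_v x c v = 0.
    have /eqP := y0 w; rewrite /y xS // sub0r oppr_eq0 mulf_eq0 (negPf gw) orbF.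
    by move/eqP.
  case: (unliftP ord0 i) => [j|] -> //.
  have := y0 (enum_val j); rewrite /y X0 mul0r subr0 => <-.
  rewrite /x (bigD1 j) //= eqxx mulr1 big1 ?addr0 // => k kj.
  by rewrite (inj_eq enum_val_inj) eq_sym (negPf kj) mulr0.
have -> : energy G (fun u => \sum_i c i * F i u) = energy G (y c).
  apply: eq_bigr => u _; apply: eq_bigr => v _; rewrite !FE.
  by congr (_ * _ ^+ 2); ring.
have -> : \sum_u (\sum_i c i * F i u) ^+ 2 =
    \sum_u y c u ^+ 2 + #|T|%:R * c ord0 ^+ 2.
  transitivity (\sum_u (y c u ^+ 2 + (2 * c ord0 * y c u + c ord0 ^+ 2))).
    by apply: eq_bigr => u _; rewrite FE; ring.
  rewrite !big_split /= -mulr_sumr sumy mulr0 add0r; congr (_ + _).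
  by rewrite sumr_const mulr_natl.
have := gap (x c) (@xS c); rewrite /= -/(y c) => gap_y.
have := energy_complement G (y c); rewrite sumy expr0n subr0.
(* The constant part has no energy, and [t <= #|T|] makes its share of the bound nonnegative. *)
have : 0 <= (#|T|%:R - t) * (#|T|%:R * c ord0 ^+ 2).
  by rewrite mulr_ge0 ?subr_ge0 // mulr_ge0 ?ler0n ?sqr_ge0.
move: gap_y; set e := energy _ _; set e' := energy _ _; set s := \sum_u _.
set r := _ * c ord0 ^+ 2; rewrite -/s => h1 h2 h3.
rewrite mulrDr; nra.
Qed.

(** * Test functions with uniformly spread weight *)

Definition inner_energy (R : pzRingType) (T : finType) (G : rel T) (S : {set T})
    (f : T -> R) : R :=
  \sum_(u in S) \sum_(v in S) (G u v)%:R * (f u - f v) ^+ 2.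

(** A shift does not change differences inside [S], and an edge from [s] to [N s] contributes
    [x s ^+ 2] in each direction; the remaining terms are nonnegative. *)
Lemma energy_ge (R : realDomainType) (T : finType) (H : sgraph T) (S : {set T})
    (N : T -> {set T}) (x y : T -> R) (c : R) :
    (forall s v, s \in S -> v \in N s -> (v \notin S) && H s v) ->
    (forall s, s \in S -> y s = x s - c) ->
    (forall s v, s \in S -> v \in N s -> y v = - c) ->
  inner_energy H S x + (\sum_(s in S) #|N s|%:R * x s ^+ 2) *+ 2 <= energy H y.
Proof.
move=> NP yS yN.
have t_ge0 u v : 0 <= (H u v)%:R * (y u - y v) ^+ 2.
  by rewrite mulr_ge0 ?sqr_ge0.
pose out := \sum_(u in S) \sum_(v | v \notin S) (H u v)%:R * (y u - y v) ^+ 2.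
have outE : \sum_(u | u \notin S) \sum_(v in S) (H u v)%:R * (y u - y v) ^+ 2 =
  out.
  rewrite exchange_big; apply: eq_bigr => u _; apply: eq_bigr => v _.
  by rewrite adj_sym -sqrrN opprB.
have -> : energy H y = inner_energy H S y + out + (out +
    \sum_(u | u \notin S) \sum_(v | v \notin S) (H u v)%:R * (y u - y v) ^+ 2).
  rewrite -{2}outE /inner_energy /out -!big_split /energy [LHS](bigID (mem S))
    /=.
  by congr (_ + _); apply: eq_bigr => u _; rewrite (bigID (mem S)).
have -> : inner_energy H S y = inner_energy H S x.
  apply: eq_bigr => u uS; apply: eq_bigr => v vS; rewrite !yS //.
  by congr (_ * _ ^+ 2); ring.
have out_ge : \sum_(s in S) #|N s|%:R * x s ^+ 2 <= out.
  apply: ler_sum => s sS;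
    rewrite mulr_natl -sumr_const [leRHS](bigID (mem (N s))) /=.
  rewrite -[leLHS]addr0 lerD ?sumr_ge0 //.
  rewrite [leRHS](eq_bigl [in N s]) => [|v]; last first.
    by case vN: (v \in N s); rewrite ?andbF // andbT; case/andP: (NP s v sS vN).
  apply: ler_sum => v vN; case/andP: (NP s v sS vN) => _ ->.
  by rewrite mul1r yS // (yN s) // opprK subrK.
rewrite mulr2n -addrA lerD2l lerD // (le_trans out_ge) // lerDl.
by apply: sumr_ge0 => u _; apply: sumr_ge0.
Qed.

(** The weight [g] is uniform on [S :|: N0], of size [M]. With [X] the sum of [x], the test function
    has squared norm [sum x ^+ 2 - X ^+ 2 / M] and equals [- X / M] on [N0], so [energy_ge] applies
    with [c = X / M]. *)
Lemma laplacian_eigenvalue_spread_le (R : rcfType) (T : finType) (G : sgraph T)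
    (S N0 : {set T}) (N : T -> {set T}) (t : R) :
    [disjoint S & N0] -> N0 != set0 -> t <= #|T|%:R ->
    (forall s v, s \in S -> v \in N s -> (v \in N0) && complement G s v) ->
    (forall x : T -> R,
      t * (\sum_(s in S) x s ^+ 2 -
           (\sum_(s in S) x s) ^+ 2 / (#|S| + #|N0|)%:R) *+ 2 <=
      inner_energy (complement G) S x +
      (\sum_(s in S) #|N s|%:R * x s ^+ 2) *+ 2) ->
  laplacian_eigenvalue R G #|S|.+1 <= #|T|%:R - t.
Proof.
move=> dSN /set0Pn[w wN0] t_le NP gap.
set M : R := (#|S| + #|N0|)%:R in gap.
have M0 : M != 0.
  by rewrite pnatr_eq0 addn_eq0 negb_and orbC -lt0n; apply/orP; left;
    apply/card_gt0P; exists w.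
have N0S v : v \in N0 -> v \notin S by move=> vN; rewrite (disjointFl dSN).
pose g u : R := if u \in S :|: N0 then M^-1 else 0.
have cardU : #|S :|: N0|%:R = M :> R.
  by rewrite cardsU (_ : S :&: N0 = set0) ?cards0 ?subn0 //;
    apply: disjoint_setI0.
clearbody M.
have sum_g (z : R) : \sum_u (if u \in S :|: N0 then z else 0) = M * z.
  by rewrite -big_mkcond sumr_const -cardU mulr_natl.
apply: (@laplacian_eigenvalue_complement_le _ _ _ _ g w) => //.
- exact: N0S.
- by rewrite /g inE wN0 orbT invr_eq0.
- by rewrite /g sum_g mulfV.
move=> x xS; set y := fun u => x u - _ * g u.
have sumS (F : T -> R) : (forall u, u \notin S -> F u = 0) ->
    \sum_u F u = \sum_(u in S) F u.
  move=> Fout; rewrite (bigID (mem S)) /= [X in _ + X]big1 ?addr0 //.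
pose X := \sum_(u in S) x u.
have yE u : y u = x u - X * g u by rewrite /y sumS.
cbv zeta; have -> : \sum_u y u ^+ 2 = \sum_(u in S) x u ^+ 2 - X ^+ 2 / M.
  transitivity (\sum_u (x u ^+ 2 - 2 * X / M * x u +
      (if u \in S :|: N0 then X ^+ 2 / M ^+ 2 else 0))).
    apply: eq_bigr => u _; rewrite yE /g inE.
    case: (boolP (u \in S)) => [_ /=|/xS->]; first by field.
    by rewrite /=; case: (u \in N0); field.
  rewrite big_split /= sum_g sumrB -mulr_sumr !sumS //; last first.
    by move=> u /xS ->; rewrite expr0n.
  by rewrite -/X; field.
apply: (le_trans (gap x)); apply: (energy_ge (c := X / M)) => //.
- by move=> s v sS vN; case/andP: (NP s v sS vN) => /N0S->.
- by move=> s sS; rewrite yE /g inE sS.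
- move=> s v sS vN; case/andP: (NP s v sS vN) => vN0 _.
  by rewrite yE xS ?N0S // /g inE vN0 orbT sub0r.
Qed.

(** * Choosing low-degree vertices and recognising the excluded graph *)

Definition take_set (T : finType) (k : nat) (A : {set T}) : {set T} :=
  [set x in take k (enum A)].

Lemma take_set_sub (T : finType) k (A : {set T}) : take_set k A \subset A.
Proof. by apply/subsetP => x; rewrite inE => /mem_take; rewrite mem_enum. Qed.

Lemma card_take_set (T : finType) k (A : {set T}) : #|take_set k A| = minn k
  #|A|.
Proof.
rewrite cardsE; have /card_uniqP -> : uniq (take k (enum A)).
  exact/take_uniq/enum_uniq.
by rewrite size_take_min -cardE.
Qed.

(** The first [m] entries of the sorted degree sequence are at most its m-th entry, so at least [m]
    vertices qualify. *)
Lemma low_degree_set (T : finType) (G : sgraph T) m :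
    (0 < m)%N -> (m <= #|T|)%N ->
  exists2 S : {set T}, #|S| = m &
    forall s, s \in S -> (degree G s <= nth_degree G m)%N.
Proof.
move=> m_gt0 m_le; pose A := [set x | (degree G x <= nth_degree G m)%N].
exists (take_set m A) => [|s /(subsetP (take_set_sub _ _))];
  last by rewrite inE.
rewrite card_take_set; apply/minn_idPl.
have sz : size (degree_seq G) = #|T| by rewrite size_sort size_map -cardE.
have -> : #|A| = count (leq^~ (nth_degree G m)) (degree_seq G).
  rewrite (permP (permEl (perm_sort _ _))) count_map cardE /enum_mem
    size_filter.
  by rewrite count_filter; apply: eq_count => x; rewrite /= !inE andbT.
rewrite -[X in (X <= _)%N](_ : size (take m (degree_seq G)) = m); last first.
  by rewrite size_takel // sz.
rewrite -[in leqRHS](cat_take_drop m (degree_seq G)) count_cat.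
apply: leq_trans (leq_addr _ _); apply/eq_leq/esym/eqP; rewrite -all_count.
apply/(all_nthP 0%N) => i; rewrite size_takel ?sz // => i_lt.
rewrite nth_take //; apply: sorted_leq_nth; rewrite ?inE ?sz.
- exact: leq_trans.
- exact: leqnn.
- exact/sort_sorted/leq_total.
- exact: leq_trans i_lt m_le.
- by rewrite prednK.
- by rewrite -ltnS prednK.
Qed.

(** The inverse isomorphism [h] enumerates [S] on the left summand and its complement on the right
    one. *)
Lemma isomorphic_clique (T : finType) (H : sgraph T) (S : {set T}) n m :
    #|T| = n -> #|S| = m ->
    (forall u v, H u v = [&& u \in S, v \in S & u != v]) ->
  isomorphic H (disjoint_union (complete_graph m) (edgeless_graph (n - m))).
Proof.
move=> cT cS HE.
have cC : #|~: S| = (n - m)%N by rewrite cardsCs setCK cT cS.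
pose h (z : ('I_m + 'I_(n - m))%type) : T :=
  match z with
  | inl i => enum_val (cast_ord (esym cS) i)
  | inr j => enum_val (cast_ord (esym cC) j)
  end.
have hS z : (h z \in S) = (if z is inl _ then true else false).
  case: z => [i|j] /=; first exact: enum_valP.
  by apply/negbTE; have := enum_valP (cast_ord (esym cC) j); rewrite inE.
have h_inj : injective h.
  move=> z1 z2 eq_h; have := hS z1; rewrite eq_h hS.
  by case: z1 z2 eq_h => [i|i] [j|j] //= /enum_val_inj/cast_ord_inj ->.
have [f hK fK] : bijective h.
  apply: (inj_card_bij h_inj).
  by rewrite card_sum !card_ord cT subnKC // -cS -cT max_card.
exists f; first by exists h.
move=> x y; rewrite -{2}(fK x) -{2}(fK y) HE !hS (inj_eq h_inj).
by case: (f x) (f y) => [i|i] [j|j].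
Qed.

(** * Inequalities for sums of squared differences *)

Section CompleteSums.
Variables (R : realFieldType) (T : finType).
Implicit Types (A B : {set T}) (x : T -> R).

Lemma sum_sqr_diff A B x :
  \sum_(u in A) \sum_(v in B) (x u - x v) ^+ 2 =
  #|B|%:R * (\sum_(u in A) x u ^+ 2) + #|A|%:R * (\sum_(v in B) x v ^+ 2) -
  (\sum_(u in A) x u) * (\sum_(v in B) x v) *+ 2.
Proof.
transitivity (\sum_(u in A) (#|B|%:R * x u ^+ 2 + \sum_(v in B) x v ^+ 2
    - x u * (\sum_(v in B) x v) *+ 2)).
  apply: eq_bigr => u _; rewrite mulr_natl -sumr_const mulr_sumr -sumrMnl.
  by rewrite -big_split -sumrB; apply: eq_bigr => v _ /=; ring.
rewrite sumrB big_split /= -mulr_sumr sumr_const mulr_natl sumrMnl -mulr_suml.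
by rewrite mulr_natl.
Qed.

(** Cauchy-Schwarz against the constant 1, read off from a nonnegative double sum of squares. *)
Lemma sqr_sum_le A x :
  (\sum_(u in A) x u) ^+ 2 <= #|A|%:R * \sum_(u in A) x u ^+ 2.
Proof.
have : 0 <= \sum_(u in A) \sum_(v in A) (x u - x v) ^+ 2.
  by apply: sumr_ge0 => u _; apply: sumr_ge0 => v _; apply: sqr_ge0.
by rewrite sum_sqr_diff; lra.
Qed.
End CompleteSums.

Lemma inner_energy_ge0 (R : realDomainType) (T : finType) (H : rel T)
    (S : {set T}) (x : T -> R) : 0 <= inner_energy H S x.
Proof.
apply: sumr_ge0 => u _; apply: sumr_ge0 => v _.
by rewrite mulr_ge0 ?sqr_ge0.
Qed.

(** The star at [s0] suffices: its edges give the squared deviations from [x s0], whose sum is least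
    when [x s0] is replaced by the mean of [x] on [S]. *)
Lemma inner_energy_universal (R : realFieldType) (T : finType) (H : sgraph T)
    (S : {set T}) (s0 : T) (x : T -> R) :
    s0 \in S -> (forall v, v \in S -> v != s0 -> H s0 v) ->
  (\sum_(s in S) x s ^+ 2 - (\sum_(s in S) x s) ^+ 2 / #|S|%:R) *+ 2 <=
  inner_energy H S x.
Proof.
move=> s0S univ; set X := \sum_(s in S) x s; set m := #|S|%:R.
have m_gt0 : 0 < m by rewrite ltr0n; apply/card_gt0P; exists s0.
have Hs0 v : v \in S -> (H s0 v)%:R * (x s0 - x v) ^+ 2 = (x v - x s0) ^+ 2.
  move=> vS; have [->|v_neq] := eqVneq v s0;
    first by rewrite subrr expr0n mulr0.
  by rewrite univ // mul1r -sqrrN opprB.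
apply: (@le_trans _ _ ((\sum_(v in S) (x v - x s0) ^+ 2) *+ 2)).
  rewrite ler_pMn2r //.
  have -> : \sum_(v in S) (x v - x s0) ^+ 2 =
      \sum_(s in S) x s ^+ 2 - 2 * x s0 * X + m * x s0 ^+ 2.
    rewrite mulr_sumr [m * _]mulr_natl -sumr_const -sumrB -big_split.
    by apply: eq_bigr => v _ /=; ring.
  rewrite -addrA lerD2l -subr_ge0.
  have -> : - (2 * x s0 * X) + m * x s0 ^+ 2 - - (X ^+ 2 / m) =
      m * (x s0 - X / m) ^+ 2 by field; rewrite gt_eqF.
  by rewrite mulr_ge0 ?sqr_ge0 ?ltW.
have t_ge0 u v : 0 <= (H u v)%:R * (x u - x v) ^+ 2.
  by rewrite mulr_ge0 ?sqr_ge0.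
rewrite /inner_energy [leRHS](bigD1 s0) //=.
have -> : \sum_(v in S) (H s0 v)%:R * (x s0 - x v) ^+ 2 =
    \sum_(v in S) (x v - x s0) ^+ 2 by apply: eq_bigr.
(* The row of [s0] has supplied one copy of the star; the entries at [s0] in the other rows supply
   the second. *)
rewrite mulr2n lerD2l (bigD1 s0) //= subrr expr0n add0r.
apply: ler_sum => u /andP[uS _]; rewrite (bigD1 s0) //= adj_sym.
rewrite -[leLHS](Hs0 u uS) -[X in _ * X <= _]sqrrN opprB lerDl.
exact: sumr_ge0.
Qed.

(** * Test functions on a set of low-degree vertices *)

Definition outer_nbrs (T : finType) (H : rel T) (S : {set T}) (s : T) :
    {set T} :=
  [set v | (v \notin S) && H s v].

(** A vertex outside [S] is adjacent to [s] in exactly one of [G] and its complement; the degree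
    also counts the G-neighbours inside [S]. *)
Lemma card_outer_nbrs (T : finType) (G : sgraph T) (S : {set T}) s :
    s \in S ->
  (#|outer_nbrs (complement G) S s| + degree G s + #|S| =
   #|T| + #|[set v in S | G s v]|)%N.
Proof.
move=> sS; rewrite /degree -(cardsID S [set y | G s y]) -(cardsC S).
rewrite -(cardsID [set y | G s y] (~: S)).
have -> : outer_nbrs (complement G) S s = ~: S :\: [set y | G s y].
  apply/setP => v; rewrite !inE /= /compl_adj andbC.
  by have [<-|_] := eqVneq s v; rewrite ?sS ?andbF /= ?andbF ?andbT 1?andbC.
rewrite setIdE setIC.
have -> : ~: S :&: [set y | G s y] = [set y | G s y] :\: S.
  by apply/setP => v; rewrite !inE.
lia.
Qed.

(* For [a] = #|A|, [p] and [P] the sums of [x] and [x ^+ 2] over [A], and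
   likewise [b], [q], [Q] for [B], the right-hand side is half the energy of the
   complete graph on [A], joined to all of [B], with one pendant edge at each
   vertex of [B]. *)
Lemma clique_pendant_le (R : realFieldType) (a b M p q P Q : R) :
    1 <= a -> 1 <= b -> 0 < M -> M <= a + 2 * b ->
    p ^+ 2 <= a * P -> q ^+ 2 <= b * Q ->
  P + Q - (p + q) ^+ 2 / M <= a * P - p ^+ 2 + (b * P + a * Q - 2 * p * q) + Q.
Proof.
move=> a1 b1 M_gt0 M_le pP qQ.
pose N := a + 2 * b.
have a_gt0 : 0 < a by lra.
have b_gt0 : 0 < b by lra.
have N_gt0 : 0 < N by rewrite /N; lra.
(* After [P >= p ^+ 2 / a] and [Q >= q ^+ 2 / b] there remains a quadratic form
   in [p], [q] with matrix [[al, -ga], [-ga, a / b + 1 / N]] and determinant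
   [(b - 1) / (a N)]. *)
pose al := (b - 1) / a + N^-1; pose ga := 1 - N^-1.
have al_gt0 : 0 < al.
  by rewrite ltr_wpDl ?invr_gt0 // divr_ge0 ?subr_ge0 // ltW.
have key : 0 <= (b - 1) * (p ^+ 2 / a) + a * (q ^+ 2 / b) - 2 * p * q +
    (p + q) ^+ 2 / N.
  have -> : (b - 1) * (p ^+ 2 / a) + a * (q ^+ 2 / b) - 2 * p * q +
      (p + q) ^+ 2 / N =
      ((al * p - ga * q) ^+ 2 + (b - 1) / (a * N) * q ^+ 2) / al.
    apply: (mulIf (lt0r_neq0 al_gt0)); rewrite divfK ?lt0r_neq0 //.
    by rewrite /al /ga /N; field; rewrite !lt0r_neq0.
  apply: divr_ge0; last exact: ltW.
  rewrite addr_ge0 ?sqr_ge0 // mulr_ge0 ?sqr_ge0 // divr_ge0 ?subr_ge0 //.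
  by apply: mulr_ge0; apply: ltW.
have hP : (b - 1) * (p ^+ 2 / a) <= (b - 1) * P.
  apply: ler_wpM2l; first by rewrite subr_ge0.
  by rewrite ler_pdivrMr // mulrC.
have hQ : a * (q ^+ 2 / b) <= a * Q.
  apply: ler_wpM2l; first exact: ltW.
  by rewrite ler_pdivrMr // mulrC.
have hN : (p + q) ^+ 2 / N <= (p + q) ^+ 2 / M.
  by apply: ler_wpM2l; rewrite ?sqr_ge0 // lef_pV2.
(* By [pP] the part [a * P - p ^+ 2] is nonnegative; what remains has coefficient [b - 1] at [P] and
   [a] at [Q], as in [hP] and [hQ]. *)
lra.
Qed.

Lemma card_bigcup_le (I T : finType) (S : {set I}) (F : I -> {set T}) :
  (#|\bigcup_(i in S) F i| <= \sum_(i in S) #|F i|)%N.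
Proof.
elim/big_rec2: _ => [|i n A _ leA]; first by rewrite cards0.
by rewrite (leq_trans (leq_card_setU _ _)) // leq_add2l.
Qed.

Section LowDegreeSet.
Variables (R : rcfType) (T : finType) (G : sgraph T) (S : {set T}).
Local Notation H := (complement G).
Local Notation out := (outer_nbrs H S).

Lemma laplacian_eigenvalue_le_outer (t : nat) :
    (#|S| < #|T|)%N -> (t <= #|T|)%N ->
    (forall s, s \in S -> (t <= #|out s|)%N) ->
  laplacian_eigenvalue R G #|S|.+1 <= #|T|%:R - t%:R.
Proof.
move=> S_lt t_le tout;
  apply: (@laplacian_eigenvalue_spread_le _ _ _ S (~: S) out).
- by rewrite disjoints_subset setCK.
- by rewrite -card_gt0 cardsCs setCK subn_gt0.
- by rewrite ler_nat.
- by move=> s v _; rewrite !inE.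
move=> x; rewrite -[leLHS]add0r lerD ?inner_energy_ge0 // ler_pMn2r //.
apply: (@le_trans _ _ (t%:R * \sum_(s in S) x s ^+ 2)).
  by rewrite ler_wpM2l // gerBl divr_ge0 ?sqr_ge0.
rewrite mulr_sumr; apply: ler_sum => s sS.
by rewrite ler_wpM2r ?sqr_ge0 // ler_nat tout.
Qed.

(* At most [e * m] vertices outside [S] are needed to supply every vertex of
   [S] with [e] outer neighbours. *)
Lemma laplacian_eigenvalue_le_universal (e : nat) (s0 : T) :
    s0 \in S -> (0 < e)%N -> (e < #|T|)%N ->
    (forall v, v \in S -> v != s0 -> H s0 v) ->
    (forall s, s \in S -> (e <= #|out s|)%N) ->
  laplacian_eigenvalue R G #|S|.+1 <= #|T|%:R - e.+1%:R.
Proof.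
move=> s0S e_gt0 e_lt univ eout.
pose N s := take_set e (out s).
have cN s : s \in S -> #|N s| = e.
  by move=> sS; rewrite card_take_set; apply/minn_idPl/eout.
have NP s v : v \in N s -> (v \notin S) && H s v.
  by move/(subsetP (take_set_sub _ _)); rewrite inE.
pose N0 := \bigcup_(s in S) N s.
have cN0 : (#|N0| <= #|S| * e)%N.
  apply: (leq_trans (card_bigcup_le _ _)).
  by rewrite (eq_bigr _ cN) sum_nat_const.
have cS : (0 < #|S|)%N by apply/card_gt0P; exists s0.
have N0_gt0 : (0 < #|N0|)%N.
  have /card_gt0P[v vN] : (0 < #|N s0|)%N by rewrite cN.
  by apply/card_gt0P; exists v; apply/bigcupP; exists s0.
apply: (@laplacian_eigenvalue_spread_le _ _ _ S N0 N).
- rewrite disjoint_sym disjoints_subset; apply/bigcupsP => s _.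
  by apply/subsetP => v /NP/andP[vS _]; rewrite inE.
- by rewrite -card_gt0.
- by rewrite ler_nat.
- by move=> s v sS vN; case/andP: (NP _ _ vN) => _ ->; rewrite andbT;
  apply/bigcupP; exists s.
move=> x; have := inner_energy_universal x s0S univ.
rewrite (_ : \sum_(s in S) #|N s|%:R * x s ^+ 2 = e%:R * \sum_(s in S) x s ^+
  2); last first.
  by rewrite mulr_sumr; apply: eq_bigr => s sS; rewrite cN.
set X := \sum_(s in S) x s; set Q := \sum_(s in S) _;
  set E := inner_energy _ _ _.
(* This is where the size of [N0] matters: [#|S| + #|N0| <= e.+1 * #|S|], so the star's defect
   [X ^+ 2 / #|S|] is absorbed. *)
move=> hE; have : X ^+ 2 / #|S|%:R <= e.+1%:R * (X ^+ 2 / (#|S| + #|N0|)%:R).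
  rewrite mulrCA ler_wpM2l ?sqr_ge0 // ler_pdivlMr ?ltr0n ?addn_gt0 ?cS //.
  rewrite mulrC ler_pdivrMr ?ltr0n // -natrM ler_nat mulSn [(e * _)%N]mulnC.
  by rewrite leq_add2l.
by rewrite -natr1; lra.
Qed.

(** Vertices of [A] have no outer neighbour and are joined to all of [S]; each vertex of [B] gets
    one chosen outer neighbour, possibly shared. Then [#|N0| <= #|B|], and [clique_pendant_le]
    applies. *)
Lemma laplacian_eigenvalue_le_pendant (s0 s1 : T) :
    s0 \in S -> s1 \in S -> out s0 = set0 -> out s1 != set0 ->
    (forall s, s \in S -> out s = set0 ->
      forall v, v \in S -> v != s -> H s v) ->
  laplacian_eigenvalue R G #|S|.+1 <= #|T|%:R - 1.
Proof.
move=> s0S s1S out0 out1 univ.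
pose A := [set s in S | out s == set0]; pose B := [set s in S | out s != set0].
have s0A : s0 \in A by rewrite inE s0S out0 eqxx.
have s1B : s1 \in B by rewrite inE s1S out1.
pose N s := take_set 1 (out s).
have cN s : #|N s| = (out s != set0) :> nat.
  rewrite card_take_set -card_gt0; case: #|out s| => [|k] //=.
  by apply/minn_idPl.
have NP s v : v \in N s -> (v \notin S) && H s v.
  by move/(subsetP (take_set_sub _ _)); rewrite inE.
pose N0 := \bigcup_(s in S) N s.
have splitS (V : nmodType) (F : T -> V) :
    \sum_(s in S) F s = \sum_(s in A) F s + \sum_(s in B) F s.
  rewrite (bigID (fun s => out s == set0)) /=.
  by congr (_ + _); apply: eq_bigl => s; rewrite inE.
have cSAB : (#|S| = #|A| + #|B|)%N by rewrite -!sum1_card; apply: splitS.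
have cN0 : (#|N0| <= #|B|)%N.
  apply: (leq_trans (card_bigcup_le _ _)).
  rewrite (eq_bigr _ (fun s _ => cN s)) splitS big1 => [|s]; last first.
    by rewrite inE => /andP[_ ->].
  rewrite add0r -sum1_card; apply: leq_sum => s _; exact: leq_b1.
have N0_gt0 : (0 < #|N0|)%N.
  have /card_gt0P[v vN] : (0 < #|N s1|)%N by rewrite cN out1.
  by apply/card_gt0P; exists v; apply/bigcupP; exists s1.
have T_gt0 : (0 < #|T|)%N by apply/card_gt0P; exists s0.
apply: (@laplacian_eigenvalue_spread_le _ _ _ S N0 N).
- rewrite disjoint_sym disjoints_subset; apply/bigcupsP => s _.
  by apply/subsetP => v /NP/andP[vS _]; rewrite inE.
- by rewrite -card_gt0.
- by rewrite ler1n.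
- by move=> s v sS vN; case/andP: (NP _ _ vN) => _ ->; rewrite andbT;
  apply/bigcupP; exists s.
(* Among the inner edges only those meeting [A] are kept; the pairs between [A] and [B] occur in
   both orders. *)
move=> x; have hE : \sum_(u in A) \sum_(v in A) (x u - x v) ^+ 2 +
    (\sum_(u in A) \sum_(v in B) (x u - x v) ^+ 2) *+ 2 <= inner_energy H S x.
  have t_ge0 u v : 0 <= (H u v)%:R * (x u - x v) ^+ 2.
    by rewrite mulr_ge0 ?sqr_ge0.
  have tE u v : u \in A -> v \in S ->
      (H u v)%:R * (x u - x v) ^+ 2 = (x u - x v) ^+ 2.
    rewrite inE => /andP[uS /eqP uout] vS.
    have [->|vu] := eqVneq v u; first by rewrite subrr expr0n mulr0.
    by rewrite univ // mul1r.
  have AS u : u \in A -> u \in S by rewrite inE => /andP[].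
  have BS u : u \in B -> u \in S by rewrite inE => /andP[].
  have AE : \sum_(u in A) \sum_(v in S) (H u v)%:R * (x u - x v) ^+ 2 =
      \sum_(u in A) \sum_(v in A) (x u - x v) ^+ 2 +
      \sum_(u in A) \sum_(v in B) (x u - x v) ^+ 2.
    rewrite -big_split; apply: eq_bigr => u uA /=; rewrite splitS.
    congr (_ + _); apply: eq_bigr => v; first by move/AS => vS; rewrite tE.
    by move/BS => vS; rewrite tE.
  rewrite /inner_energy splitS AE mulr2n addrA lerD2l exchange_big /=.
  apply: ler_sum => v vB; rewrite splitS -[leLHS]addr0 lerD ?sumr_ge0 //.
    apply: ler_sum => u uA.
    by rewrite compl_adj_sym -[leLHS](tE u v uA (BS v vB)) -[X in _ <= _ *
      X]sqrrN opprB.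
  by move=> u _; apply: t_ge0.
apply: le_trans (lerD hE (lexx _)).
rewrite !splitS cSAB !sum_sqr_diff.
have -> : \sum_(s in A) #|N s|%:R * x s ^+ 2 = 0.
  by apply: big1 => s; rewrite inE => /andP[_ /eqP o0];
    rewrite cN o0 eqxx mul0r.
have -> : \sum_(s in B) #|N s|%:R * x s ^+ 2 = \sum_(s in B) x s ^+ 2.
  by apply: eq_bigr => s; rewrite inE => /andP[_ o1]; rewrite cN o1 mul1r.
have hA := sqr_sum_le A x; have hB := sqr_sum_le B x.
have a1 : 1 <= #|A|%:R :> R by rewrite ler1n; apply/card_gt0P; exists s0.
have b1 : 1 <= #|B|%:R :> R by rewrite ler1n; apply/card_gt0P; exists s1.
have M_gt0 : 0 < (#|A| + #|B| + #|N0|)%:R :> R by rewrite ltr0n; lia.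
have M_le : (#|A| + #|B| + #|N0|)%:R <= #|A|%:R + 2 * #|B|%:R :> R.
  by rewrite -natrM -natrD ler_nat; lia.
have := clique_pendant_le a1 b1 M_gt0 M_le hA hB; lra.
Qed.

(** The test function is [x] minus its mean on [S], [X] at [u], [- X] at [v] and 0 elsewhere. The
    clique yields [m >= 1] times the squared norm of the centred part, and the edge [uv] pays for
    the two outer values. *)
Lemma laplacian_eigenvalue_le_clique (u v : T) :
    (0 < #|S|)%N -> u \notin S -> v \notin S -> H u v ->
    (forall s s', s \in S -> s' \in S -> s' != s -> H s s') ->
  laplacian_eigenvalue R G #|S|.+1 <= #|T|%:R - 1.
Proof.
move=> S_gt0 uS vS Huv clique.
have uv : u != v by case/andP: Huv.
have neqS s w : s \in S -> w \notin S -> (s == w) = false.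
  by move=> sS wS; apply: contraNF wS => /eqP <-.
set m : R := #|S|%:R.
have m1 : 1 <= m by rewrite ler1n.
have m0 : m != 0 by rewrite lt0r_neq0 // (lt_le_trans ltr01).
pose g w : R := (if w \in S then m^-1 else 0) - (w == u)%:R + (w == v)%:R.
have sum_S (F : T -> R) : \sum_z (if z \in S then F z else 0) = \sum_(z in S) F
  z.
  by rewrite -big_mkcond.
apply: (@laplacian_eigenvalue_complement_le _ _ _ _ g u) => //.
- by rewrite /g (negPf uS) eqxx (negPf uv) sub0r addr0 oppr_eq0 oner_eq0.
- rewrite /g big_split sumrB /= sum_S sumr_const -mulr_natl mulfV //.
  have sum1 w : \sum_(z : T) (z == w)%:R = 1 :> R.
    by rewrite (bigD1 w) //= eqxx big1 ?addr0 // => z /negPf->.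
  by rewrite !sum1 subrK.
- by rewrite ler1n; apply/card_gt0P; exists u.
move=> x xS; set X := \sum_w x w; cbv zeta.
set y := fun w => x w - X * g w.
have XE : X = \sum_(w in S) x w.
  rewrite -sum_S; apply: eq_bigr => w _.
  by case: (boolP (w \in S)) => // /xS.
have yS w : w \in S -> y w = x w - X / m.
  by move=> wS; rewrite /y /g wS !neqS // subr0 addr0.
have yu : y u = X.
  by rewrite /y /g xS // (negPf uS) eqxx (negPf uv) /=; ring.
have yv : y v = - X.
  by rewrite /y /g xS // (negPf vS) eqxx eq_sym (negPf uv) /=; ring.
have y0 w : w \notin S -> w != u -> w != v -> y w = 0.
  by move=> wS wu wv; rewrite /y /g xS // (negPf wS) (negPf wu) (negPf wv) /=;
    ring.
have -> : \sum_w y w ^+ 2 = \sum_(w in S) x w ^+ 2 - X ^+ 2 / m + 2 * X ^+ 2.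
  rewrite (bigID (mem S)) /=; congr (_ + _).
    transitivity (\sum_(w in S) (x w ^+ 2 - 2 * (X / m) * x w + (X / m) ^+ 2)).
      by apply: eq_bigr => w wS; rewrite yS // /=; ring.
    rewrite big_split sumrB /= -mulr_sumr -XE sumr_const -[_ *+ #|S|]mulr_natl
      -/m.
    by field.
  rewrite (bigD1 u) //= (bigD1 v) /=; last by rewrite vS eq_sym uv.
  rewrite big1 => [|w /andP[/andP[wS wu] wv]]; last by rewrite y0 // expr0n.
  by rewrite yu yv; ring.
have inner : (m * \sum_(w in S) x w ^+ 2 - X ^+ 2) *+ 2 <= inner_energy H S y.
  have -> : (m * \sum_(w in S) x w ^+ 2 - X ^+ 2) *+ 2 =
      \sum_(w in S) \sum_(z in S) (x w - x z) ^+ 2.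
    by rewrite sum_sqr_diff -XE -/m; ring.
  apply: ler_sum => w wS; apply: ler_sum => z zS.
  have [->|zw] := eqVneq z w; first by rewrite subrr expr0n mulr_ge0 ?sqr_ge0.
  rewrite clique // mul1r !yS //.
  by rewrite (_ : x w - X / m - (x z - X / m) = x w - x z) //; ring.
have t_ge0 w z : 0 <= (H w z)%:R * (y w - y z) ^+ 2.
  by rewrite mulr_ge0 ?sqr_ge0.
(* The edge [uv] contributes [(2 * X) ^+ 2] in each direction. *)
have outer : 8 * X ^+ 2 <=
    \sum_(w | w \notin S) \sum_z (H w z)%:R * (y w - y z) ^+ 2.
  rewrite (bigD1 u) //= [Z in _ <= _ + Z](bigD1 v) /=;
    last by rewrite vS eq_sym uv.
  rewrite (bigD1 v) //= [Z in _ <= _ + (Z + _)](bigD1 u) //=.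
  have Hvu : compl_adj G v u by rewrite compl_adj_sym.
  rewrite {1}[compl_adj G u v]Huv Hvu yu yv !mul1r.
  have s1 : 0 <= \sum_(i | i != v) (compl_adj G u i)%:R * (X - y i) ^+ 2.
    by apply: sumr_ge0 => i _; rewrite -yu; apply: t_ge0.
  have s2 : 0 <= \sum_(i | i != u) (compl_adj G v i)%:R * (- X - y i) ^+ 2.
    by apply: sumr_ge0 => i _; rewrite -yv; apply: t_ge0.
  have s3 : 0 <= \sum_(i | (i \notin S) && (i != u) && (i != v))
      \sum_z (compl_adj G i z)%:R * (y i - y z) ^+ 2.
    by apply: sumr_ge0 => i _; apply: sumr_ge0 => z _; apply: t_ge0.
  nra.
have : inner_energy H S y +
    \sum_(w | w \notin S) \sum_z (H w z)%:R * (y w - y z) ^+ 2 <= energy H y.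
  rewrite /energy [leRHS](bigID (mem S)) /= lerD2r; apply: ler_sum => w wS.
  rewrite [leRHS](bigID (mem S)) /= lerDl; apply: sumr_ge0 => z _; exact: t_ge0.
have : 0 <= (m - 1) * (\sum_(w in S) x w ^+ 2 - X ^+ 2 / m).
  rewrite mulr_ge0 ?subr_ge0 // ler_pdivrMr ?(lt_le_trans ltr01) // mulrC XE.
  exact: sqr_sum_le.
have : m * (X ^+ 2 / m) = X ^+ 2 by rewrite mulrC divfK.
have := sqr_ge0 X; move: inner outer; rewrite mul1r.
move: (energy _ _) (inner_energy _ _ _) (\sum_(w | w \notin S) _).
move: (\sum_(w in S) _).
move: (X ^+ 2 / m) (X ^+ 2) => r q Q e e1 e2.
lra.
Qed.
End LowDegreeSet.

(** * The bound, by cases on the outer neighbours *)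

Theorem theorem2 (R : rcfType) (T : finType) (G : sgraph T) (n m : nat)
    (cardT : #|T| = n) (m_ge1 : (1 <= m)%N) (m_le : (m <= n - 1)%N)
    (neqG : ~ isomorphic (complement G)
                (disjoint_union (complete_graph m) (edgeless_graph (n - m)))) :
  laplacian_eigenvalue R G m.+1 <= (nth_degree G m)%:R + m%:R - 1.
Proof.
set d := nth_degree G m.
have m_lt : (m < #|T|)%N by lia.
have [S cS Sd] := low_degree_set G m_ge1 (ltnW m_lt).
have outP s : s \in S -> (n + #|[set v in S | G s v]| <=
    #|outer_nbrs (complement G) S s| + d + m)%N.
  move=> sS; rewrite -cardT -card_outer_nbrs // cS leq_add2r leq_add2l.
  exact: Sd.
(* Subtraction truncates: if [n <= d + m - 1] then [t = 0] and the first case applies;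
   [n - t <= d + m - 1] holds in any event. *)
pose t := (n - (d + m - 1))%N.
apply: (@le_trans _ _ (#|T|%:R - t%:R)); last first.
  have : (#|T| + 1 <= d + m + t)%N by lia.
  by rewrite -(ler_nat R) !natrD; lra.
rewrite -cS.
have [/forall_inP t_le|/forall_inPn[s0 s0S out0]] :=
  boolP [forall s in S, (t <= #|outer_nbrs (complement G) S s|)%N].
  by apply: laplacian_eigenvalue_le_outer => //; [rewrite cS | lia].
(* A G-neighbour inside [S] would raise the count in [outP] by one, giving [t] outer neighbours. *)
have univ s : s \in S -> (#|outer_nbrs (complement G) S s| < t)%N ->
    forall v, v \in S -> v != s -> complement G s v.
  move=> sS s_lt v vS vs; rewrite /= /compl_adj eq_sym vs /=; apply/negP => Gsv.
  have : (0 < #|[set v in S | G s v]|)%N.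
    by apply/card_gt0P; exists v; rewrite inE vS.
  by have := outP s sS; lia.
rewrite -ltnNge in out0.
have [t_gt1|t_le1] := ltnP 1 t.
  rewrite -[t]prednK; last by lia.
  apply: (@laplacian_eigenvalue_le_universal _ _ _ _ _ s0) => //.
  - by lia.
  - by lia.
  - exact: univ.
  - by move=> s /outP; lia.
(* [out0] forces [t] to be positive, and [s0] then has no outer neighbour at all. *)
have t1 : t = 1%N by lia.
have {}univ s : s \in S -> outer_nbrs (complement G) S s = set0 ->
    forall v, v \in S -> v != s -> complement G s v.
  by move=> sS s0E; apply: univ => //; rewrite s0E cards0 t1.
have {}out0 : outer_nbrs (complement G) S s0 = set0.
  by apply: cards0_eq; lia.
rewrite t1.
have [/exists_inP[s1 s1S out1]|/exists_inPn outS] :=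
  boolP [exists s in S, outer_nbrs (complement G) S s != set0].
  exact: (laplacian_eigenvalue_le_pendant R s0S s1S).
have {}outS s : s \in S -> outer_nbrs (complement G) S s = set0.
  by move/outS; rewrite negbK => /eqP.
have [/existsP[u /existsP[v /and3P[uS vS Huv]]]|noedge] :=
  boolP [exists u, exists v, [&& u \notin S, v \notin S & complement G u v]].
  apply: (laplacian_eigenvalue_le_clique R _ uS vS Huv); first by rewrite cS.
  by move=> s s' sS s'S ss'; apply: univ => //; apply: outS.
(* Now [S] is an isolated clique of the complement with no edge outside it, which is the excluded
   graph. *)
have outF s v : s \in S -> v \notin S -> complement G s v = false.
  move=> sS vS; apply/negP => Hsv; have := outS s sS.
  by move/setP/(_ v); rewrite !inE vS Hsv.
case: neqG; apply: isomorphic_clique cardT cS _ => u v.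
have [uS|uS] := boolP (u \in S); have [vS|vS] := boolP (v \in S) => /=.
- have [->|uv] := eqVneq u v; first by exact: compl_adj_irrefl.
  by apply: univ => //; [apply: outS | rewrite eq_sym].
- exact: outF.
- by rewrite -[LHS]/(complement G u v) adj_sym outF.
- apply/negP => Huv; case/negP: noedge; apply/existsP; exists u.
  by apply/existsP; exists v; rewrite uS vS.
Qed.
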